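(* Let $(X,\mathcal{R})$ be a $Q$-polynomial association scheme of class $D\geq 2$ with $Q$-polynomial ordering $E_0,E_1,\ldots,E_D$ of the primitive idempotents, dual eigenvalues $\theta_0^*=m>\theta_1^*>\cdots>\theta_D^*$ and dual intersection numbers $a_i^*,b_i^*,c_i^*$ (as in the context). \begin{enumerate} \item $(\theta_1^*+1)(\theta_D^*+1)\leq -b_1^*$, with equality if and only if $D=2$. \item Assume $D\geq 3$. If $b_2^*+c_3^*\geq m+1$, then $(\theta_1^*+1)(\theta_{D-1}^*+1)(\theta_D^*+1)\geq -b_1^*(m+1-b_2^*-c_3^* )$. If $b_2^*+c_3^*\leq m+1$, then $(\theta_1^*+1)(\theta_{2}^*+1)(\theta_D^*+1)\leq -b_1^*(m+1-b_2^*-c_3^* )$. Moreover, equality holds in either case if and only if $D=3$. \end{enumerate}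
   Context: $(X,\mathcal{R})$ is a (symmetric) association scheme on a finite set $X$ with adjacency matrices $A_0=I,A_1,\ldots,A_D$ and primitive idempotents $E_0=\frac{1}{|X|}J,E_1,\ldots,E_D$ of its Bose–Mesner algebra. Krein parameters $q_{i,j}^h$ are defined by $E_i\circ E_j=\frac{1}{|X|}\sum_{h=0}^D q_{i,j}^h E_h$, where $\circ$ is the entrywise product. The scheme is $Q$-polynomial with respect to the ordering $E_0,\ldots,E_D$ if $q_{1,j}^h=0$ whenever $|h-j|>1$ and $q_{1,j}^h\neq 0$ whenever $|h-j|=1$. Set $a_i^*=q_{1,i}^i$, $b_i^*=q_{1,i+1}^i$ ($0\le i\le D-1$), $c_i^*=q_{1,i-1}^i$ ($1\le i\le D$), and $m=b_0^*=q_{1,1}^0=\operatorname{rank}E_1$; then $a_i^*+b_i^*+c_i^*=m$. The dual eigenvalues $\theta_h^*$ are defined by $E_1=\frac{1}{|X|}\sum_{h=0}^D\theta_h^*A_h$, and the relations are indexed so that $\theta_0^*=m>\theta_1^*>\cdots>\theta_D^*$. *)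

(* Defs.v *)
From HB Require Import structures.
From mathcomp Require Import all_boot all_order all_algebra.

Set Implicit Arguments.
Unset Strict Implicit.
Unset Printing Implicit Defensive.

Import Order.TTheory GRing.Theory Num.Theory.
Local Open Scope ring_scope.

(* A family of relations R_0, ..., R_D partitioning X * X is encoded by the
   function r sending (x, y) to the index of the unique relation containing
   it; surjectivity of r says that every R_i is nonempty. *)
Record symmetric_scheme (X : finType) (D : nat) (r : X -> X -> 'I_D.+1) :
    Prop := SymmetricScheme {
  scheme_nonempty : forall i, exists x y, r x y = i;
  scheme_diag : forall x y, r x y = ord0 <-> x = y;
  scheme_sym : forall x y, r x y = r y x;
  scheme_inter : forall i j h, exists p : nat, forall x y, r x y = h ->
    #|[set z | (r x z == i) && (r z y == j)]| = p
}.

Section BoseMesner.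

Variables (R : rcfType) (X : finType) (D : nat) (r : X -> X -> 'I_D.+1).

Implicit Types (M N E F G : 'M[R]_#|X|).

(* Rows and columns are indexed by X through the bijection enum_val. *)
Definition adjacency (i : 'I_D.+1) : 'M[R]_#|X| :=
  \matrix_(x, y) (r (enum_val x) (enum_val y) == i)%:R.

Definition bose_mesner M : Prop :=
  exists c : 'I_D.+1 -> R, M = \sum_i c i *: adjacency i.

Definition bm_idempotent E : Prop := bose_mesner E /\ E *m E = E.

Definition primitive_idempotent E : Prop :=
  [/\ bm_idempotent E, E <> 0 &
      forall F G, bm_idempotent F -> bm_idempotent G ->
        F *m G = 0 -> G *m F = 0 -> E = F + G -> F = 0 \/ G = 0].

Definition idempotent_ordering (E : 'I_D.+1 -> 'M[R]_#|X|) : Prop :=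
  [/\ injective E,
      forall F, primitive_idempotent F <-> exists i, F = E i &
      E ord0 = #|X|%:R^-1 *: const_mx 1].

Definition entrywise_mul M N : 'M[R]_#|X| := map2_mx *%R M N.

(* q i j h is the Krein parameter q_{i,j}^h; the E h being linearly
   independent, the equation determines q. *)
Definition krein_parameters (E : 'I_D.+1 -> 'M[R]_#|X|)
    (q : 'I_D.+1 -> 'I_D.+1 -> 'I_D.+1 -> R) : Prop :=
  forall i j, entrywise_mul (E i) (E j) =
    #|X|%:R^-1 *: \sum_h q i j h *: E h.

(* The adjacency matrices being linearly independent, the equation determines
   theta. *)
Definition dual_eigenvalues (E : 'I_D.+1 -> 'M[R]_#|X|)
    (theta : 'I_D.+1 -> R) : Prop :=
  E (inord 1) = #|X|%:R^-1 *: \sum_h theta h *: adjacency h.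

End BoseMesner.

Section DualIntersectionNumbers.

Variables (R : rcfType) (D : nat).
Variable q : 'I_D.+1 -> 'I_D.+1 -> 'I_D.+1 -> R.

Definition q_polynomial : Prop := forall j h : 'I_D.+1,
  (1 < `|h%:Z - j%:Z| -> q (inord 1) j h = 0) /\
  (`|h%:Z - j%:Z| = 1 -> q (inord 1) j h <> 0).

(* Meaningful for i < D only. *)
Definition bstar (i : nat) : R := q (inord 1) (inord i.+1) (inord i).

(* Meaningful for 0 < i <= D only. *)
Definition cstar (i : nat) : R := q (inord 1) (inord i.-1) (inord i).

End DualIntersectionNumbers.

(* Main.v *)
Require Import Defs.
From HB Require Import structures.
From mathcomp Require Import all_boot all_order all_algebra.
From mathcomp Require Import ring lra zify.

Set Implicit Arguments.
Unset Strict Implicit.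
Unset Printing Implicit Defensive.

Import Order.TTheory GRing.Theory Num.Theory.
Local Open Scope ring_scope.

(* Write E_i = |X|^-1 sum_h u_i(h) A_h, so that u_1 = theta.  The partial sums
   F_i = u_0 + ... + u_i are polynomials in t = theta + 1, orthogonal for the
   measure with mass k_h (m - theta_h) at t_h, and F_D vanishes at every
   h <> 0.  Here F_1 = t, and c_2 c_3 F_3 is the monic cubic
   P = (t - d_2)((t - d_1) t - b_1) - b_2 c_2 t with d_2 = m + 1 - b_2 - c_3,
   whose value at 0 is b_1 d_2.  Positivity of the b_i and c_i follows from
   ||F_i||^2 > 0.

   Integrating (t_1 - t)(t - t_D) >= 0 gives the quadratic inequality.  If
   D = 3 the roots of P are the t_h.  If D > 3, integrating P against suitable
   quadratics shows that the extreme t_h lie strictly outside the roots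
   x > y > z of P, that t_2 > y and that t_{D-1} < y; the sign of
   P(0) = - x y z then determines how the products compare.  The two cubic
   inequalities are exchanged by t -> - t. *)

Section Cubics.

Variable R : rcfType.
Implicit Types b d e t x y z : R.

Definition cubic d1 d2 b e t : R := (t - d2) * ((t - d1) * t - b) - e * t.

Lemma cubicN d1 d2 b e t :
  cubic (- d1) (- d2) b e (- t) = - cubic d1 d2 b e t.
Proof. rewrite /cubic; ring. Qed.

Lemma cubic_factor d1 d2 b e x y z : y < x -> z < y ->
    cubic d1 d2 b e x = 0 -> cubic d1 d2 b e y = 0 ->
    cubic d1 d2 b e z = 0 ->
  forall t, cubic d1 d2 b e t = (t - x) * (t - y) * (t - z).
Proof.
rewrite /cubic => yx zy px py pz t.
have xy0 : x - y != 0 by rewrite subr_eq0 gt_eqF.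
have yz0 : y - z != 0 by rewrite subr_eq0 gt_eqF.
have xz0 : x - z != 0 by rewrite subr_eq0 gt_eqF // (lt_trans zy).
pose q u v : R := u ^+ 2 + u * v + v ^+ 2 - (d1 + d2) * (u + v) + (d1 * d2 - b - e).
have exy : q x y = 0.
  by apply: (mulfI xy0); rewrite mulr0 -[RHS](subrr 0) -{1}px -py /q; ring.
have eyz : q y z = 0.
  by apply: (mulfI yz0); rewrite mulr0 -[RHS](subrr 0) -{1}py -pz /q; ring.
have d2E : d2 = x + y + z - d1.
  apply: (mulfI xz0); apply/eqP; rewrite -subr_eq0 -oppr_eq0; apply/eqP.
  by rewrite -[RHS](subrr 0) -{1}exy -eyz /q; ring.
have eE : e = d1 * d2 - b - (x * y + x * z + y * z).
  by rewrite -[LHS]addr0 -exy /q d2E; ring.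
by rewrite -[LHS]subr0 -px eE d2E; ring.
Qed.

Lemma cubic_top_root d1 d2 b e : 0 < b -> 0 < e ->
  exists x y, [/\ 0 < x, x < y, cubic d1 d2 b e x < 0 & cubic d1 d2 b e y = 0].
Proof.
move=> b0 e0.
pose s := Num.sqrt (d1 ^+ 2 + 4 * b).
have s2 : s ^+ 2 = d1 ^+ 2 + 4 * b by rewrite sqr_sqrtr //; nra.
have s0 : 0 <= s by rewrite sqrtr_ge0.
pose x := (d1 + s) / 2.
have x0 : 0 < x.
  rewrite divr_gt0 //.
  have: `|d1| < s.
    by rewrite -(ltr_pXn2r (n := 2)) ?nnegrE // real_normK ?num_real // s2; lra.
  by rewrite ltr_norml => /andP[]; lra.
have xE : (x - d1) * x - b = 0.
  by rewrite /x; field: s2.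
have cx : cubic d1 d2 b e x < 0.
  by rewrite /cubic xE mulr0 sub0r oppr_lt0 mulr_gt0.
pose M := x + 1 + `|d1| + `|d2| + b + e.
have n1 : 0 <= `|d1| by []. have n2 : 0 <= `|d2| by [].
have l1 := ler_norm d1. have l2 := ler_norm d2.
have cM : 0 <= cubic d1 d2 b e M.
  have M1 : 1 <= M by rewrite /M; lra.
  have Md1 : 1 + b + e <= M - d1 by rewrite /M; lra.
  have Md2 : 1 <= M - d2 by rewrite /M; lra.
  have H1 : (1 + b + e) * M <= (M - d1) * M by rewrite ler_wpM2r //; lra.
  have H2 : (1 + e) * M <= (M - d1) * M - b.
    by have : 0 <= b * (M - 1) by [rewrite mulr_ge0 //; lra]; lra.
  have H3 : 1 * ((1 + e) * M) <= (M - d2) * ((M - d1) * M - b).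
    by apply: ler_pM => //; rewrite mulr_ge0 //; lra.
  by rewrite /cubic; lra.
pose p : {poly R} := ('X - d2%:P) * (('X - d1%:P) * 'X - b%:P) - e *: 'X.
have pE t : p.[t] = cubic d1 d2 b e t by rewrite !hornerE.
have xM : x <= M by rewrite /M; lra.
have := @poly_ivt R p x M xM; rewrite !pE (ltW cx) cM => /(_ isT).
move=> [y /andP[xy yM]]; rewrite /root pE => /eqP cy.
exists x, y; split => //; rewrite lt_neqAle xy andbT.
by apply: contraTneq cx => ->; rewrite cy ltxx.
Qed.

Lemma cubic_roots d1 d2 b e : 0 < b -> 0 < e ->
  exists x y z, [/\ 0 < x, z < 0, y < x, z < y &
    forall t, cubic d1 d2 b e t = (t - x) * (t - y) * (t - z)].
Proof.
move=> b0 e0.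
have [x' [x [x'0 x'x cx' cx]]] := cubic_top_root d1 d2 b0 e0.
have [z' [z [z'0 z'z]]] := cubic_top_root (- d1) (- d2) b0 e0.
rewrite -[z']opprK -[z]opprK !cubicN oppr_lt0 => cz' /eqP.
rewrite oppr_eq0 => /eqP cz.
pose p : {poly R} := e *: 'X - ('X - d2%:P) * (('X - d1%:P) * 'X - b%:P).
have pE t : p.[t] = - cubic d1 d2 b e t by rewrite !hornerE /cubic; ring.
have zx : - z' <= x' by lra.
have := @poly_ivt R p _ _ zx; rewrite !pE !oppr_cp0 (ltW cx') (ltW cz').
move=> /(_ isT) [y /andP[zy yx]]; rewrite /root pE oppr_eq0 => /eqP cy.
have yx' : y < x by lra.
have zy' : - z < y by lra.
by exists x, y, (- z); split; [lra | lra | | | exact: cubic_factor].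
Qed.

End Cubics.

Section PositiveSums.

Variables (R : rcfType) (I : finType) (w : I -> R).
Hypothesis w_gt0 : forall i, 0 < w i.

Lemma wsum_eq0 (f : I -> R) :
  (forall i, 0 <= f i) -> \sum_i w i * f i = 0 -> forall i, f i = 0.
Proof.
move=> f0 sf i; have /eqP : w i * f i = 0.
  by apply: (psumr_eq0P _ sf) => // j _; rewrite mulr_ge0 // ltW.
by rewrite mulf_eq0 gt_eqF //= => /eqP.
Qed.

Variable t : I -> R.
Hypothesis t_inj : injective t.

Lemma card_le_values (s : seq R) : (forall i, t i \in s) -> (#|I| <= size s)%N.
Proof.
move=> ts; rewrite cardE -(size_map t); apply: uniq_leq_size.
  by rewrite map_inj_uniq ?enum_uniq.
by move=> _ /mapP[i _ ->].
Qed.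

Lemma product_top_bottom b i1 i2 :
    \sum_i w i * t i = 0 -> \sum_i w i * t i ^+ 2 = b * \sum_i w i ->
    (forall i, t i <= t i1) -> (forall i, t i2 <= t i) -> i1 != i2 ->
  t i1 * t i2 <= - b /\ (t i1 * t i2 = - b <-> #|I| = 2).
Proof.
move=> s1 s2 h1 h2 i12; pose f i := (t i1 - t i) * (t i - t i2).
have f0 i : 0 <= f i by rewrite mulr_ge0 ?subr_ge0.
have S0 : 0 < \sum_i w i.
  by rewrite (bigD1 i1) //= ltr_pwDl // sumr_ge0 // => i _; apply: ltW.
have sf : \sum_i w i * f i = (- b - t i1 * t i2) * \sum_i w i.
  transitivity ((t i1 + t i2) * (\sum_i w i * t i) - \sum_i w i * t i ^+ 2
      - t i1 * t i2 * \sum_i w i); last by rewrite s1 s2; ring.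
  rewrite !mulr_sumr -!sumrB; apply: eq_bigr => i _; rewrite /f; ring.
have I2 : (2 <= #|I|)%N.
  by have := max_card (pred2 i1 i2); rewrite card2 i12.
split.
  rewrite -subr_ge0 -(pmulr_lge0 _ S0) -sf.
  by apply: sumr_ge0 => i _; rewrite mulr_ge0 // ltW.
split=> [eb|I2'].
  apply/eqP; rewrite eqn_leq I2 andbT.
  apply: (@card_le_values [:: t i1; t i2]) => i.
  have := wsum_eq0 f0 (etrans sf _) i; rewrite eb subrr mul0r => /(_ erefl)/eqP.
  by rewrite mulf_eq0 !subr_eq0 !inE eq_sym.
apply/eqP; rewrite eq_sym -subr_eq0 -(mulIr_eq0 _ (mulIf (lt0r_neq0 S0))) -sf.
apply/eqP/big1 => i _.
have : i \in [set i1; i2].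
  suff -> : [set i1; i2] = [set: I] by rewrite inE.
  by apply/eqP; rewrite eqEcard subsetT cards2 i12 cardsT I2'.
by rewrite !inE /f => /orP[]/eqP->; rewrite subrr ?mul0r !mulr0.
Qed.

Section Interlacing.

Variables (x y z : R).
Hypotheses (zy : z < y) (card4 : (3 < #|I|)%N).
Let P i := (t i - x) * (t i - y) * (t i - z).
Hypothesis P_orth0 : \sum_i w i * P i = 0.
Hypothesis P_orth1 : \sum_i w i * (P i * t i) = 0.
Hypothesis P_orth2 : \sum_i w i * (P i * t i ^+ 2) = 0.

(* A quadratic multiple of P of constant sign must vanish on the support, so
   it suffices to choose one with at most three zeros. *)
Let P_sign a b c (s : seq R) : (size s <= 3)%N ->
    (forall i, 0 <= c * (P i * ((t i - a) * (t i - b)))) ->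
    (forall i, c * (P i * ((t i - a) * (t i - b))) = 0 -> t i \in s) -> False.
Proof.
move=> s3 f0 fs.
have f_eq0 : forall i, c * (P i * ((t i - a) * (t i - b))) = 0.
  apply: wsum_eq0 => //.
  transitivity (c * (\sum_i w i * (P i * t i ^+ 2)
     - (a + b) * (\sum_i w i * (P i * t i)) + a * b * \sum_i w i * P i)).
    rewrite !mulr_sumr -sumrN -!big_split mulr_sumr.
    by apply: eq_bigr => i _ /=; ring.
  by rewrite P_orth0 P_orth1 P_orth2; ring.
have := card_le_values (fun i => fs i (f_eq0 i)).
by rewrite leqNgt (leq_ltn_trans s3 card4).
Qed.

Lemma top_gt i1 : (forall i, t i <= t i1) -> x < t i1.
Proof.
move=> t1; rewrite ltNge; apply/negP => t1x.
apply: (@P_sign y z (-1) [:: x; y; z]) => // i.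
  have tx : 0 <= x - t i by rewrite subr_ge0 (le_trans (t1 i)).
  have := mulr_ge0 tx (sqr_ge0 ((t i - y) * (t i - z))).
  by congr (_ <= _); rewrite /P; ring.
move/eqP; rewrite /P !mulf_eq0 !subr_eq0 oppr_eq0 oner_eq0 !inE.
by do ![case: eqP => //= _].
Qed.

Lemma bottom_lt i1 : (forall i, t i1 <= t i) -> t i1 < z.
Proof.
move=> t1; rewrite ltNge; apply/negP => t1z.
apply: (@P_sign x y 1 [:: x; y; z]) => // i.
  have tz : 0 <= t i - z by rewrite subr_ge0 (le_trans t1z).
  have := mulr_ge0 tz (sqr_ge0 ((t i - x) * (t i - y))).
  by congr (_ <= _); rewrite /P; ring.
move/eqP; rewrite /P !mulf_eq0 !subr_eq0 oner_eq0 !inE.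
by do ![case: eqP => //= _].
Qed.

Lemma second_bottom_lt i1 i2 : (forall i, t i1 <= t i) ->
  (forall i, i != i1 -> t i2 <= t i) -> t i2 < y.
Proof.
move=> t1 t2; rewrite ltNge; apply/negP => t2y.
apply: (@P_sign x (t i1) 1 [:: x; y; t i1]) => // i.
  have [->|ii1] := eqVneq i i1.
    by rewrite subrr !mulr0.
  have ty : 0 <= t i - y by rewrite subr_ge0 (le_trans t2y) ?t2.
  have tz : 0 <= t i - z by rewrite (le_trans ty) // lerD2l lerN2 ltW.
  have tt : 0 <= t i - t i1 by rewrite subr_ge0.
  have := mulr_ge0 (mulr_ge0 ty tz) (mulr_ge0 tt (sqr_ge0 (t i - x))).
  by congr (_ <= _); rewrite /P; ring.
have [->|ii1] := eqVneq i i1; first by rewrite !inE eqxx !orbT.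
have tz : t i == z = false.
  by apply/gt_eqF/(lt_le_trans zy)/(le_trans t2y)/t2.
move/eqP; rewrite /P !mulf_eq0 !subr_eq0 oner_eq0 tz !inE.
by do ![case: eqP => //= _].
Qed.

End Interlacing.

Lemma product_gt (d1 d2 b e : R) i1 i2 i3 : 0 < b -> 0 < e -> (3 < #|I|)%N ->
    \sum_i w i * cubic d1 d2 b e (t i) = 0 ->
    \sum_i w i * (cubic d1 d2 b e (t i) * t i) = 0 ->
    \sum_i w i * (cubic d1 d2 b e (t i) * t i ^+ 2) = 0 ->
    (forall i, t i <= t i1) -> (forall i, t i3 <= t i) ->
    (forall i, i != i3 -> t i2 <= t i) -> d2 <= 0 ->
  - b * d2 < t i1 * t i2 * t i3.
Proof.
move=> b0 e0 I4 s0 s1 s2 h1 h3 h2 d20.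
have [x [y [z [x0 z0 yx zy cE]]]] := cubic_roots d1 d2 b0 e0.
pose P i := (t i - x) * (t i - y) * (t i - z).
have {}s0 : \sum_i w i * P i = 0 by under eq_bigr do rewrite /P -cE.
have {}s1 : \sum_i w i * (P i * t i) = 0 by under eq_bigr do rewrite /P -cE.
have {}s2 : \sum_i w i * (P i * t i ^+ 2) = 0 by under eq_bigr do rewrite /P -cE.
have l1 := top_gt I4 s0 s1 s2 h1.
have l2 := second_bottom_lt zy I4 s0 s1 s2 h3 h2.
have l3 := bottom_lt I4 s0 s1 s2 h3.
have c0 : - b * d2 = x * y * z by have := cE 0; rewrite /cubic; lra.
have y0 : y <= 0.
  rewrite leNgt; apply/negP => y0.
  have : 0 < x * y * - z by rewrite !mulr_gt0 // oppr_gt0.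
  have : 0 <= b * - d2 by rewrite mulr_ge0 ?oppr_ge0 // ltW.
  lra.
rewrite c0 -!mulrA -[y * z]mulrNN -[t i2 * t i3]mulrNN.
apply: ltr_pM => //; [exact: ltW | | by apply: ltr_pM; lra].
by rewrite mulr_ge0 ?oppr_ge0 // ltW.
Qed.

End PositiveSums.

Lemma product_lt (R : rcfType) (I : finType) (w t : I -> R)
    (d1 d2 b e : R) i1 i2 i3 :
    (forall i, 0 < w i) -> injective t ->
    0 < b -> 0 < e -> (3 < #|I|)%N ->
    \sum_i w i * cubic d1 d2 b e (t i) = 0 ->
    \sum_i w i * (cubic d1 d2 b e (t i) * t i) = 0 ->
    \sum_i w i * (cubic d1 d2 b e (t i) * t i ^+ 2) = 0 ->
    (forall i, t i <= t i1) -> (forall i, t i3 <= t i) ->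
    (forall i, i != i1 -> t i <= t i2) -> 0 <= d2 ->
  t i1 * t i2 * t i3 < - b * d2.
Proof.
move=> w0 tinj b0 e0 I4 s0 s1 s2 h1 h3 h2 d20.
rewrite -ltrN2.
have -> : - (t i1 * t i2 * t i3) = - t i3 * - t i2 * - t i1 by ring.
have -> : - (- b * d2) = - b * - d2 by ring.
apply: (@product_gt R I w w0 (fun i => - t i) _ (- d1) _ b e) => //.
- by move=> i j /oppr_inj/tinj.
- by rewrite -[RHS]oppr0 -[in RHS]s0 -sumrN; apply: eq_bigr => i _; rewrite cubicN mulrN.
- by rewrite -[RHS]s1; apply: eq_bigr => i _; rewrite cubicN mulrNN.
- rewrite -[RHS]oppr0 -[in RHS]s2 -sumrN; apply: eq_bigr => i _.
  by rewrite cubicN sqrrN mulNr mulrN.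
- by move=> i; rewrite lerN2.
- by move=> i; rewrite lerN2.
- by move=> i /h2; rewrite lerN2.
- by rewrite oppr_le0.
Qed.

Section BoseMesnerAlgebra.

Variables (R : rcfType) (X : finType) (D : nat) (r : X -> X -> 'I_D.+1).
Hypothesis r_scheme : symmetric_scheme r.

Local Notation rel x y := (r (enum_val x) (enum_val y)).
Local Notation BM := (@bose_mesner R X D r).
Implicit Types M N : 'M[R]_#|X|.

Definition pair_count (h : 'I_D.+1) : R :=
  \sum_(x < #|X|) \sum_(y < #|X|) (rel x y == h)%:R.

Lemma bose_mesnerP (M : 'M[R]_#|X|) :
  BM M <-> exists c, forall x y, M x y = c (rel x y).
Proof.
have entry c x y : (\sum_i c i *: adjacency R r i) x y = c (rel x y).
  rewrite summxE (bigD1 (rel x y)) //= !mxE eqxx mulr1 big1 ?addr0 // => i.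
  by rewrite !mxE eq_sym => /negPf->; rewrite mulr0.
split=> [[c ->]|[c Mc]]; exists c; first by move=> x y; rewrite entry.
by apply/matrixP => x y; rewrite entry.
Qed.

Lemma relP h : exists x y : 'I_#|X|, rel x y = h.
Proof.
have [x [y <-]] := scheme_nonempty r_scheme h.
by exists (enum_rank x), (enum_rank y); rewrite !enum_rankK.
Qed.

Lemma rel_eq0 (x y : 'I_#|X|) : (rel x y == ord0) = (x == y).
Proof.
apply/eqP/eqP => [/(scheme_diag r_scheme)|->]; first exact: enum_val_inj.
exact/(scheme_diag r_scheme).
Qed.

Lemma card_scheme_gt0 : (0 < #|X|)%N.
Proof. by have [x _] := relP ord0; apply: leq_ltn_trans (ltn_ord x). Qed.

Lemma pair_count_gt0 h : 0 < pair_count h.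
Proof.
have [x [y xy]] := relP h.
rewrite /pair_count (bigD1 x) //= (bigD1 y) //= xy eqxx -addrA.
by rewrite ltr_pwDl // addr_ge0 // !sumr_ge0 // => i _; rewrite sumr_ge0.
Qed.

Lemma pair_count0 : pair_count ord0 = #|X|%:R.
Proof.
rewrite /pair_count; under eq_bigr do under eq_bigr do rewrite rel_eq0.
under eq_bigr => x _.
  rewrite (bigD1 x) //= eqxx big1 ?addr0; last first.
    by move=> y; rewrite eq_sym => /negPf->.
  over.
by rewrite sumr_const card_ord.
Qed.

Lemma bose_mesner_tr M : BM M -> M^T = M.
Proof.
move=> /bose_mesnerP[c Mc]; apply/matrixP => x y.
by rewrite !mxE !Mc (scheme_sym r_scheme).
Qed.

Lemma bose_mesnerB M N : BM M -> BM N -> BM (M - N).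
Proof.
move=> /bose_mesnerP[c Mc] /bose_mesnerP[d Nd]; apply/bose_mesnerP.
by exists (fun i => c i - d i) => x y; rewrite !mxE Mc Nd.
Qed.

Lemma bose_mesnerM M N : BM M -> BM N -> BM (M *m N).
Proof.
move=> /bose_mesnerP[c Mc] /bose_mesnerP[d Nd]; apply/bose_mesnerP.
pose p i j x y := #|[set z | (r x z == i) && (r z y == j)]|.
have MN x y : (M *m N) x y =
    \sum_i \sum_j c i * d j * (p i j (enum_val x) (enum_val y))%:R.
  rewrite mxE (reindex (@enum_rank X)) /=; last first.
    by apply: onW_bij; exists enum_val; [exact: enum_rankK | exact: enum_valK].
  under eq_bigr do rewrite Mc Nd enum_rankK.
  under [RHS]eq_bigr do under eq_bigr do
    rewrite /p -sum1dep_card natr_sum mulr_sumr big_mkcond.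
  under [RHS]eq_bigr do rewrite exchange_big.
  rewrite [RHS]exchange_big; apply: eq_bigr => z _ /=.
  rewrite (bigD1 (r (enum_val x) z)) //= (bigD1 (r z (enum_val y))) //=.
  rewrite !eqxx mulr1 !big1 ?addr0 // => [i|j].
    by rewrite eq_sym => /negPf nz; rewrite big1 // => j _; rewrite nz.
  by rewrite eq_sym => /negPf ->; rewrite andbF.
pose P h := [pick z : X * X | r z.1 z.2 == h].
exists (fun h => if P h is Some z then \sum_i \sum_j c i * d j * (p i j z.1 z.2)%:R
                 else 0) => x y.
rewrite MN /P; case: pickP => [[x' y'] /= /eqP xy'|/(_ (enum_val x, enum_val y))]; last first.
  by rewrite eqxx.
apply: eq_bigr => i _; apply: eq_bigr => j _; congr (_ * _%:R).
by have [n pn] := scheme_inter r_scheme i j (rel x y); rewrite /p !pn.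
Qed.

Lemma bose_mesnerC M N : BM M -> BM N -> M *m N = N *m M.
Proof.
move=> BMM BMN; rewrite -(bose_mesner_tr (bose_mesnerM BMM BMN)).
by rewrite trmx_mul !bose_mesner_tr.
Qed.

Lemma primitive_idempotent_mul (M N : 'M[R]_#|X|) :
    primitive_idempotent r M -> bm_idempotent r N ->
  M *m N = 0 \/ M *m N = M.
Proof.
move=> [[BMM MM] M0 Mprim] [BMN NN].
have MNC := bose_mesnerC BMM BMN.
have MNM : M *m N *m M = M *m N by rewrite MNC -mulmxA MM.
have MNMN : M *m N *m (M *m N) = M *m N by rewrite mulmxA MNM -mulmxA NN.
have MMN : M *m (M *m N) = M *m N by rewrite mulmxA MM.
have BMMN := bose_mesnerM BMM BMN.
have [||||||/eqP] := Mprim (M *m N) (M - M *m N).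
- by split.
- split; first exact: bose_mesnerB.
  by rewrite mulmxBl !mulmxBr MM MNM MMN MNMN subrr subr0.
- by rewrite mulmxBr MNM MNMN subrr.
- by rewrite mulmxBl MMN MNMN subrr.
- by rewrite addrC subrK.
- by left.
by rewrite subr_eq0 => /eqP MN; right.
Qed.

Lemma primitive_idempotent_orth (M N : 'M[R]_#|X|) :
    primitive_idempotent r M -> primitive_idempotent r N -> M <> N ->
  M *m N = 0.
Proof.
move=> Mp Np MN; have [[BMM MM] _ _] := Mp; have [[BMN NN] _ _] := Np.
have [//|eM] := primitive_idempotent_mul Mp (conj BMN NN).
have [|eN] := primitive_idempotent_mul Np (conj BMM MM).
  by rewrite bose_mesnerC.
by case: MN; rewrite -eM -[RHS]eN bose_mesnerC.
Qed.

Section Idempotents.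

Variable E : 'I_D.+1 -> 'M[R]_#|X|.
Hypothesis E_ordering : idempotent_ordering r E.

Let E_prim i : primitive_idempotent r (E i).
Proof. by case: E_ordering => _ EP _; apply/EP; exists i. Qed.

(* The entries Q_{h,i} of the second eigenmatrix, with
   E_i = |X|^-1 sum_h Q_{h,i} A_h. *)
Definition scaled_coef (i h : 'I_D.+1) : R :=
  if [pick z : 'I_#|X| * 'I_#|X| | rel z.1 z.2 == h] is Some z
  then #|X|%:R * E i z.1 z.2 else 0.

Let n0 : #|X|%:R != 0 :> R.
Proof. by rewrite pnatr_eq0 -lt0n card_scheme_gt0. Qed.

Lemma scaled_coefE i x y : scaled_coef i (rel x y) = #|X|%:R * E i x y.
Proof.
have [[/bose_mesnerP[c Ec] _] _ _] := E_prim i.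
rewrite /scaled_coef; case: pickP => [z /eqP zxy|/(_ (x, y))]; last by rewrite eqxx.
by rewrite !Ec zxy.
Qed.

Lemma sum_rel (f : 'I_D.+1 -> R) :
  \sum_(x < #|X|) \sum_(y < #|X|) f (rel x y) = \sum_h pair_count h * f h.
Proof.
under [RHS]eq_bigr do rewrite mulr_suml.
rewrite [RHS]exchange_big; apply: eq_bigr => x _ /=.
under [RHS]eq_bigr do rewrite mulr_suml.
rewrite [RHS]exchange_big; apply: eq_bigr => y _ /=.
rewrite (bigD1 (rel x y)) //= eqxx mul1r big1 ?addr0 // => h.
by rewrite eq_sym => /negPf->; rewrite mul0r.
Qed.

Local Notation u := scaled_coef.

(* |X|^2 times the usual multiplicity, because [pair_count h] is |X| times the
   valency. *)
Definition multiplicity i : R := #|X|%:R ^+ 2 * \tr (E i).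

Lemma coef_orth i j :
  \sum_h pair_count h * (u i h * u j h) = if i == j then multiplicity i else 0.
Proof.
rewrite -sum_rel; transitivity (#|X|%:R ^+ 2 * \tr (E i *m E j)).
  rewrite /mxtrace mulr_sumr; apply: eq_bigr => x _.
  rewrite mxE mulr_sumr; apply: eq_bigr => y _.
  rewrite !scaled_coefE; have [[BMj _] _ _] := E_prim j.
  by rewrite -{2}(bose_mesner_tr BMj) mxE; ring.
case: eqP => [<-|ij]; first by have [[_ ->]] := E_prim i.
rewrite primitive_idempotent_orth ?mxtrace0 ?mulr0 //.
by move=> /(let: And3 H _ _ := E_ordering in H i j).
Qed.

Lemma multiplicity_gt0 i : 0 < multiplicity i.
Proof.
have := coef_orth i i; rewrite eqxx => <-.
have ge0 h : 0 <= pair_count h * (u i h * u i h).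
  by rewrite mulr_ge0 -?expr2 ?sqr_ge0 // ltW ?pair_count_gt0.
rewrite lt_def sumr_ge0 ?andbT //; apply/eqP => s0.
have [_ + _] := E_prim i; apply; apply/matrixP => x y.
rewrite mxE; apply: (mulfI n0); rewrite mulr0 -scaled_coefE.
have /eqP := psumr_eq0P (fun h _ => ge0 h) s0 (i := rel x y) isT.
by rewrite mulf_eq0 gt_eqF ?pair_count_gt0 //= mulf_eq0 orbb => /eqP.
Qed.

Lemma coef_ord0 h : u ord0 h = 1.
Proof.
have [x [y <-]] := relP h; rewrite scaled_coefE.
by case: E_ordering => _ _ ->; rewrite !mxE mulr1 divff.
Qed.

Lemma coef_0 i : #|X|%:R ^+ 2 * u i ord0 = multiplicity i.
Proof.
rewrite expr2 -mulrA; transitivity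
  (#|X|%:R * \sum_h pair_count h * (u i h * (h == ord0)%:R)).
  rewrite [X in _ = _ * X](bigD1 ord0) //= pair_count0 mulr1 big1 ?addr0 // => h.
  by move=> /negPf->; rewrite !mulr0.
rewrite -(sum_rel (fun h => u i h * (h == ord0)%:R)) /multiplicity expr2 -mulrA.
congr (_ * _); rewrite mulr_sumr; apply: eq_bigr => x _.
rewrite (bigD1 x) //= scaled_coefE rel_eq0 eqxx mulr1 big1 ?addr0 // => y.
by rewrite rel_eq0 eq_sym => /negPf->; rewrite mulr0.
Qed.

(* The row orthogonality [coef_orth] makes the second eigenmatrix invertible, so
   its columns are orthogonal too; column [ord0] lists the multiplicities. *)
Lemma sum_coef h : \sum_i u i h = if h == ord0 then #|X|%:R else 0.
Proof.
pose U : 'M[R]_D.+1 := \matrix_(i, j) u i j.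
pose V : 'M[R]_D.+1 := \matrix_(j, i) (pair_count j * u i j / multiplicity i).
have UV : U *m V = 1%:M.
  apply/matrixP => i j; rewrite !mxE; under eq_bigr do rewrite !mxE.
  transitivity ((\sum_l pair_count l * (u i l * u j l)) / multiplicity j).
    by rewrite mulr_suml; apply: eq_bigr => l _; ring.
  rewrite coef_orth; have [->|] := eqVneq i j; last by rewrite mul0r.
  by rewrite divff // gt_eqF ?multiplicity_gt0.
have /matrixP/(_ h ord0) := mulmx1C UV; rewrite !mxE => VU.
apply: (mulfI (lt0r_neq0 (pair_count_gt0 h))).
transitivity (#|X|%:R ^+ 2 * \sum_i V h i * U i ord0).
  rewrite !mulr_sumr; apply: eq_bigr => i _; rewrite !mxE.
  have := multiplicity_gt0 i; rewrite -coef_0 => /lt0r_neq0 nz.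
  have uz : u i ord0 != 0 by apply: contraNneq nz => ->; rewrite mulr0.
  by field; rewrite n0 uz.
rewrite VU; case: eqVneq => [->|]; last by rewrite !mulr0.
by rewrite pair_count0 mulr1 expr2.
Qed.

Lemma coef_mul q i j h : krein_parameters E q ->
  u i h * u j h = \sum_l q i j l * u l h.
Proof.
move=> q_krein; have [x [y <-]] := relP h; rewrite !scaled_coefE.
have := congr1 (fun M : 'M__ => #|X|%:R ^+ 2 * M x y) (q_krein i j).
rewrite !mxE summxE => H.
transitivity (#|X|%:R ^+ 2 * (E i x y * E j x y)); first by ring.
rewrite H mulrA expr2 mulfK // mulr_sumr; apply: eq_bigr => l _.
by rewrite scaled_coefE mxE; ring.
Qed.

Lemma coef_dual theta h : dual_eigenvalues r E theta ->
  u (inord 1) h = theta h.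
Proof.
have [x [y <-]] := relP h; rewrite scaled_coefE => ->.
rewrite mxE mulrA divff // mul1r summxE (bigD1 (rel x y)) //= !mxE eqxx mulr1.
rewrite big1 ?addr0 // => l.
by rewrite !mxE eq_sym => /negPf->; rewrite mulr0.
Qed.

End Idempotents.

End BoseMesnerAlgebra.

Section OrthogonalRecurrence.

Variables (R : rcfType) (D : nat) (u q1 : 'I_D.+1 -> 'I_D.+1 -> R).
Variables (K M : 'I_D.+1 -> R) (N : R).
Hypothesis K_gt0 : forall h, 0 < K h.
Hypothesis M_gt0 : forall i, 0 < M i.
Hypothesis u_orth : forall i j,
  \sum_h K h * (u i h * u j h) = if i == j then M i else 0.
Hypothesis u_ord0 : forall h, u ord0 h = 1.
Hypothesis u_sum : forall h, \sum_i u i h = if h == ord0 then N else 0.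
Hypothesis u_mul : forall j h, u (inord 1) h * u j h = \sum_l q1 j l * u l h.
Hypothesis q1_eq0 : forall j h : 'I_D.+1, (j.+1 < h)%N || (h.+1 < j)%N -> q1 j h = 0.
Hypothesis q1_neq0 : forall j h : 'I_D.+1, (j.+1 == h)%N || (h.+1 == j)%N -> q1 j h != 0.
Local Notation th := (u (inord 1)).
Hypothesis th_decr : forall h k : 'I_D.+1, (h < k)%N -> th k < th h.
Hypothesis D2 : (2 <= D)%N.

Local Notation b i := (q1 (inord i%N.+1) (inord i%N)).
Local Notation c i := (q1 (inord i%N.-1) (inord i%N)).

Lemma dot_expand i (a : 'I_D.+1 -> R) :
  \sum_h K h * (u i h * \sum_l a l * u l h) = a i * M i.
Proof.
under eq_bigr do rewrite !mulr_sumr.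
rewrite exchange_big (bigD1 i) //= [X in _ + X]big1 ?addr0 => [|l li].
  transitivity (a i * \sum_h K h * (u i h * u i h)); last by rewrite u_orth eqxx.
  by rewrite mulr_sumr; apply: eq_bigr => h _; ring.
transitivity (a l * \sum_h K h * (u i h * u l h)).
  by rewrite mulr_sumr; apply: eq_bigr => h _; ring.
by rewrite u_orth eq_sym (negPf li) mulr0.
Qed.

(* The paper's a_i^* + b_i^* + c_i^* = m; both sides are coefficients of
   [theta u_0 + ... + theta u_D], which is supported at [ord0]. *)
Lemma col_sum l : \sum_j q1 j l = th ord0.
Proof.
apply: (mulIf (lt0r_neq0 (M_gt0 l))).
rewrite -(dot_expand l (fun l => \sum_j q1 j l)) -(dot_expand l (fun=> th ord0)).
apply: eq_bigr => h _; congr (_ * (_ * _)).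
transitivity (th h * \sum_j u j h).
  rewrite mulr_sumr; under [RHS]eq_bigr do rewrite u_mul.
  by rewrite exchange_big; apply: eq_bigr => i _; rewrite mulr_suml.
rewrite -mulr_sumr u_sum; case: eqVneq => [->//|_]; by rewrite !mulr0.
Qed.

Lemma q1_sym j l : q1 j l * M l = q1 l j * M j.
Proof.
rewrite -(dot_expand l (q1 j)) -(dot_expand j (q1 l)).
by apply: eq_bigr => h _; rewrite -!u_mul; ring.
Qed.

Lemma q1_row0 l : q1 ord0 l = (l == inord 1)%:R.
Proof.
apply: (mulIf (lt0r_neq0 (M_gt0 l))); rewrite -(dot_expand l (q1 ord0)).
under eq_bigr do rewrite -u_mul u_ord0 mulr1.
by rewrite u_orth; case: eqP; rewrite ?mul1r ?mul0r.
Qed.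

Lemma inord0 : inord 0 = ord0 :> 'I_D.+1.
Proof. by apply: val_inj; rewrite /= inordK. Qed.

Lemma b0E : b 0%N = th ord0.
Proof.
rewrite -(col_sum ord0) inord0 (bigD1 ord0) //= (bigD1 (inord 1)) /=; last first.
  by rewrite -val_eqE /= inordK //; lia.
rewrite q1_row0 -val_eqE /= inordK; last lia.
rewrite add0r big1 ?addr0 // => j /andP[j0 j1]; apply: q1_eq0.
by move: j0 j1; rewrite -!val_eqE /= inordK; lia.
Qed.

Definition partial_sum (i : nat) h : R := \sum_(l < D.+1) (l <= i)%N%:R * u l h.

Lemma partial_sum0 h : partial_sum 0 h = 1.
Proof.
rewrite /partial_sum (bigD1 ord0) //= mul1r u_ord0 big1 ?addr0 // => l l0.
by rewrite leqn0 -[_ == 0%N]/(l == ord0) (negPf l0) mul0r.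
Qed.

Lemma partial_sumS i h : (i < D)%N ->
  partial_sum i.+1 h = partial_sum i h + u (inord i.+1) h.
Proof.
move=> iD; rewrite /partial_sum (bigD1 (inord i.+1)) //= inordK // leqnn mul1r addrC.
rewrite [X in _ = X + _](bigD1 (inord i.+1)) //= inordK // ltnn mul0r add0r.
congr (_ + _); apply: eq_bigr => l; rewrite -val_eqE /= inordK // => li.
by congr (_%:R * _); congr (nat_of_bool _); lia.
Qed.

Lemma partial_sumD h : partial_sum D h = if h == ord0 then N else 0.
Proof.
by rewrite -u_sum; apply: eq_bigr => l _; rewrite -ltnS ltn_ord mul1r.
Qed.

Lemma partial_sum_rec i h : (i < D)%N ->
  (th h - th ord0) * partial_sum i h = c i.+1 * u (inord i.+1) h - b i * u (inord i) h.
Proof.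
move=> iD.
transitivity (\sum_(l < D.+1)
  (\sum_(j < D.+1) (j <= i)%N%:R * q1 j l - th ord0 * (l <= i)%N%:R) * u l h).
  rewrite mulrBl /partial_sum !mulr_sumr; under eq_bigr do rewrite mulrCA u_mul mulr_sumr.
  rewrite exchange_big -sumrB; apply: eq_bigr => l _ /=.
  rewrite mulrBl mulr_suml mulrA; congr (_ - _).
  by apply: eq_bigr => j _; rewrite mulrA.
have ni : inord i.+1 != inord i :> 'I_D.+1 by rewrite -val_eqE /= !inordK; lia.
rewrite (bigD1 (inord i.+1)) // (bigD1 (inord i)) 1?eq_sym //=.
rewrite [X in _ + (_ + X)]big1 ?addr0 => [|l].
  congr (_ + _).
    congr (_ * _); rewrite inordK // ltnn mulr0 subr0.
    rewrite (bigD1 (inord i)) //= inordK ?leqnn ?mul1r; last lia.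
    rewrite big1 ?addr0 // => j; rewrite -val_eqE /= inordK => [ji|]; last lia.
    have [ji'|_] := leqP j i; last by rewrite mul0r.
    by rewrite q1_eq0 ?mulr0 // inordK //; lia.
  rewrite -[RHS]mulNr; congr (_ * _); rewrite inordK ?leqnn ?mulr1; last lia.
  rewrite -(col_sum (inord i)) -sumrB (bigD1 (inord i.+1)) //= inordK // ltnn.
  rewrite mul0r sub0r big1 ?addr0 // => j; rewrite -val_eqE /= inordK // => ji.
  have [ji'|ji'] := leqP j i; first by rewrite mul1r subrr.
  by rewrite mul0r q1_eq0 ?subrr // inordK //; lia.
move=> /andP[]; rewrite -!val_eqE /= !inordK => [l1 l2| |]; [|lia..].
suff -> : \sum_(j < D.+1) (j <= i)%N%:R * q1 j l = th ord0 * (l <= i)%N%:R.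
  by rewrite subrr mul0r.
have [li|li] := leqP l i.
  rewrite mulr1 -(col_sum l); apply: eq_bigr => j _.
  have [|ji] := leqP j i; first by rewrite mul1r.
  by rewrite mul0r q1_eq0 //; lia.
rewrite mulr0 big1 // => j _; have [ji|] := leqP j i; last by rewrite mul0r.
by rewrite q1_eq0 ?mulr0 //; lia.
Qed.

(* The orthogonality measure of the partial sums; it vanishes at [ord0]. *)
Definition weight h : R := K h * (th ord0 - th h).

Lemma weight_ord0 : weight ord0 = 0. Proof. by rewrite /weight subrr mulr0. Qed.

Lemma weight_gt0 h : h != ord0 -> 0 < weight h.
Proof.
by rewrite -lt0n => h0; rewrite mulr_gt0 // subr_gt0 th_decr.
Qed.

Lemma weight_ge0 h : 0 <= weight h.
Proof. by have [->|/weight_gt0/ltW//] := eqVneq h ord0; rewrite weight_ord0. Qed.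

Lemma partial_sum_orth i j : (i < D)%N -> (j <= i)%N ->
  \sum_h weight h * (partial_sum i h * partial_sum j h) =
    if i == j then b i * M (inord i) else 0.
Proof.
move=> iD ji.
transitivity (b i * (\sum_h K h * (u (inord i) h * partial_sum j h))
   - c i.+1 * (\sum_h K h * (u (inord i.+1) h * partial_sum j h))).
  rewrite !mulr_sumr -sumrB; apply: eq_bigr => h _.
  transitivity (- K h * ((th h - th ord0) * partial_sum i h * partial_sum j h)).
    by rewrite /weight; ring.
  by rewrite partial_sum_rec //; ring.
rewrite !dot_expand !inordK //; last lia.
rewrite [(i < j)%N]ltnNge ji /= mul0r mulr0 subr0 eqn_leq ji andbT.
by case: (i <= j)%N; rewrite ?mul1r ?mul0r ?mulr0.
Qed.

Lemma b_gt0 i : (i < D)%N -> 0 < b i.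
Proof.
move=> iD; rewrite -(pmulr_lgt0 _ (M_gt0 (inord i))) lt_def mulf_neq0 /=.
- have := partial_sum_orth iD (leqnn i); rewrite eqxx => <-; apply: sumr_ge0 => h _.
  by rewrite mulr_ge0 ?weight_ge0 // -expr2 sqr_ge0.
- by apply: q1_neq0; rewrite !inordK ?eqxx ?orbT //; lia.
by rewrite gt_eqF.
Qed.

Lemma c_gt0 i : (i < D)%N -> 0 < c i.+1.
Proof.
move=> iD; rewrite -(pmulr_lgt0 _ (M_gt0 (inord i.+1))) q1_sym mulr_gt0 //.
exact: b_gt0.
Qed.

Lemma M1E : M (inord 1) = b 0 * M ord0.
Proof.
have := q1_sym ord0 (inord 1); rewrite /= inord0 => <-.
by rewrite q1_row0 eqxx mul1r.
Qed.

Definition shifted h : R := th h + 1.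

Lemma partial_sum1 h : partial_sum 1 h = shifted h.
Proof. by rewrite partial_sumS ?partial_sum0 1?addrC //; lia. Qed.

Lemma partial_sum2 h :
  c 2 * partial_sum 2 h = (shifted h - (b 0 + 1 - b 1 - c 2)) * shifted h - b 1.
Proof.
have := @partial_sum_rec 1 h D2; rewrite -b0E partial_sum1.
by rewrite [partial_sum 2 h]partial_sumS // partial_sum1 /shifted; lra.
Qed.

Lemma partial_sum3 h : (3 <= D)%N -> c 2 * c 3 * partial_sum 3 h =
  cubic (b 0 + 1 - b 1 - c 2) (b 0 + 1 - b 2 - c 3) (b 1) (b 2 * c 2) (shifted h).
Proof.
move=> D3; rewrite /cubic -partial_sum2.
have := @partial_sum_rec 2 h D3; rewrite -b0E [partial_sum 3 h]partial_sumS // => rec.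
have u2E : u (inord 2) h = partial_sum 2 h - shifted h.
  by rewrite [partial_sum 2 h]partial_sumS // partial_sum1; ring.
rewrite mulrDr -[c 2 * c 3 * u _ _]mulrA.
rewrite (_ : c 3 * _ = (th h - b 0) * partial_sum 2 h + b 2 * u (inord 2) h).
  by rewrite u2E /shifted; ring.
by rewrite rec; ring.
Qed.

Lemma shifted_moment1 : \sum_h weight h * shifted h = 0.
Proof.
transitivity (\sum_h weight h * (partial_sum 1 h * partial_sum 0 h)); last first.
  exact: (@partial_sum_orth 1 0 D2 isT).
by apply: eq_bigr => h _; rewrite partial_sum1 partial_sum0 mulr1.
Qed.

Lemma shifted_moment2 : \sum_h weight h * shifted h ^+ 2 = b 1 * \sum_h weight h.
Proof.
have D0 : (0 < D)%N by lia.
have := @partial_sum_orth 0 0 D0 isT; have := @partial_sum_orth 1 1 D2 isT.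
rewrite /= inord0 => H1 H0.
transitivity (b 1 * M (inord 1)).
  by rewrite -H1; apply: eq_bigr => h _; rewrite partial_sum1.
rewrite M1E /= inord0 -H0; congr (_ * _).
by apply: eq_bigr => h _; rewrite partial_sum0 !mulr1.
Qed.

Lemma cubic_orth j : (3 < D)%N -> (j <= 2)%N ->
  \sum_h weight h * (cubic (b 0 + 1 - b 1 - c 2) (b 0 + 1 - b 2 - c 3) (b 1)
    (b 2 * c 2) (shifted h) * partial_sum j h) = 0.
Proof.
move=> D3 j2; under eq_bigr => h _ do rewrite -partial_sum3 1?ltnW // -mulrA mulrCA.
by rewrite -mulr_sumr partial_sum_orth ?ifN ?mulr0 //; lia.
Qed.

Lemma sum_lift (f : 'I_D.+1 -> R) :
  \sum_(i < D) weight (lift ord0 i) * f (lift ord0 i) = \sum_h weight h * f h.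
Proof. by rewrite big_ord_recl weight_ord0 mul0r add0r. Qed.

Local Notation node := (fun i : 'I_D => shifted (lift ord0 i)).
Local Notation node_weight := (fun i : 'I_D => weight (lift ord0 i)).

Lemma node_weight_gt0 i : 0 < node_weight i. Proof. exact: weight_gt0. Qed.

Lemma node_lt (i j : 'I_D) : (i < j)%N -> node j < node i.
Proof. by move=> ij; rewrite ltrD2r th_decr. Qed.

Lemma node_le (i j : 'I_D) : (i <= j)%N -> node j <= node i.
Proof.
rewrite leq_eqVlt => /orP[/eqP/val_inj->//|/node_lt/ltW//].
Qed.

Lemma node_inj : injective node.
Proof.
move=> i j ij; apply/val_inj/eqP.
by case: ltngtP => // /node_lt; rewrite ij ltxx.
Qed.

Lemma nodeE k (kD : (k < D)%N) : node (Ordinal kD) = shifted (inord k.+1).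
Proof. by congr (shifted _); apply: val_inj; rewrite /= inordK. Qed.

Lemma dual_top_bottom :
  shifted (inord 1) * shifted (inord D) <= - b 1 /\
  (shifted (inord 1) * shifted (inord D) = - b 1 <-> D = 2).
Proof.
have D0 : (0 < D)%N by lia. have D1 : (D.-1 < D)%N by lia.
have inordD : inord D = inord D.-1.+1 :> 'I_D.+1 by rewrite prednK.
have -> : (D = 2) = (#|'I_D| = 2) by rewrite card_ord.
rewrite inordD -(nodeE D0) -(nodeE D1).
apply: (@product_top_bottom R 'I_D node_weight node_weight_gt0 node node_inj).
- by rewrite (sum_lift shifted) shifted_moment1.
- rewrite (sum_lift (fun h => shifted h ^+ 2)) shifted_moment2.
  by rewrite [in LHS]big_ord_recl weight_ord0 add0r.
- by move=> i; apply: node_le.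
- by move=> i; apply: node_le; have := ltn_ord i; rewrite /=; lia.
by rewrite -val_eqE /=; lia.
Qed.

Local Notation d2 := (b 0 + 1 - b 2 - c 3).

Lemma cubic_sums : (3 < D)%N ->
  let C h := cubic (b 0 + 1 - b 1 - c 2) d2 (b 1) (b 2 * c 2) (shifted h) in
  [/\ \sum_h weight h * C h = 0, \sum_h weight h * (C h * shifted h) = 0
    & \sum_h weight h * (C h * shifted h ^+ 2) = 0].
Proof.
move=> D3 C.
have S0 : \sum_h weight h * C h = 0.
  rewrite -[RHS](@cubic_orth 0 D3 isT); apply: eq_bigr => h _.
  by rewrite partial_sum0 mulr1.
have S1 : \sum_h weight h * (C h * shifted h) = 0.
  by rewrite -[RHS](@cubic_orth 1 D3 isT); apply: eq_bigr => h _; rewrite partial_sum1.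
split=> //.
transitivity (c 2 * (\sum_h weight h * (C h * partial_sum 2 h))
  + (b 0 + 1 - b 1 - c 2) * (\sum_h weight h * (C h * shifted h))
  + b 1 * \sum_h weight h * C h).
  rewrite !mulr_sumr -!big_split; apply: eq_bigr => h _ /=.
  rewrite (_ : c 2 * _ = weight h * C h * (c 2 * partial_sum 2 h)); last by ring.
  by rewrite partial_sum2; ring.
by rewrite S0 S1 (@cubic_orth 2 D3 isT) !mulr0 !addr0.
Qed.

Lemma dual_product3 : D = 3 ->
  shifted (inord 1) * shifted (inord 2) * shifted (inord 3) = - b 1 * d2.
Proof.
move=> D3; have F3_0 k : (0 < k <= 3)%N ->
    cubic (b 0 + 1 - b 1 - c 2) d2 (b 1) (b 2 * c 2) (shifted (inord k)) = 0.
  move=> k3; rewrite -partial_sum3 ?D3 // -[X in partial_sum X]D3 partial_sumD.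
  rewrite -val_eqE /= inordK; last lia.
  by case: k k3 => // k _; rewrite mulr0.
have t21 : shifted (inord 2) < shifted (inord 1) by rewrite ltrD2r th_decr // !inordK; lia.
have t32 : shifted (inord 3) < shifted (inord 2) by rewrite ltrD2r th_decr // !inordK; lia.
have := cubic_factor t21 t32 (F3_0 1%N isT) (F3_0 2%N isT) (F3_0 3%N isT) 0.
rewrite /cubic; lra.
Qed.

Lemma dual_product_gt : (3 < D)%N -> d2 <= 0 ->
  - b 1 * d2 < shifted (inord 1) * shifted (inord D.-1) * shifted (inord D).
Proof.
move=> D3 d20; have [S0 S1 S2] := cubic_sums D3.
have D0 : (0 < D)%N by lia. have D1 : (D.-1 < D)%N by lia.
have D2' : (D.-2 < D)%N by lia.
have -> : inord D.-1 = inord D.-2.+1 :> 'I_D.+1 by congr inord; lia.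
have inordD : inord D = inord D.-1.+1 :> 'I_D.+1 by rewrite prednK.
rewrite inordD -!nodeE.
apply: (@product_gt R 'I_D node_weight node_weight_gt0 node node_inj
  (b 0 + 1 - b 1 - c 2) _ _ (b 2 * c 2)) => //.
- by apply: b_gt0.
- by apply: mulr_gt0; [apply: b_gt0; lia | apply: c_gt0; lia].
- by rewrite card_ord.
- by rewrite -[RHS]S0 -[RHS]sum_lift.
- by rewrite -[RHS]S1 -[RHS]sum_lift.
- by rewrite -[RHS]S2 -[RHS]sum_lift.
- by move=> i; apply: node_le.
- by move=> i; apply: node_le; have := ltn_ord i; rewrite /=; lia.
move=> i; rewrite -val_eqE /= => iD; apply: node_le.
by have := ltn_ord i; rewrite /=; lia.
Qed.

Lemma dual_product_lt : (3 < D)%N -> 0 <= d2 ->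
  shifted (inord 1) * shifted (inord 2) * shifted (inord D) < - b 1 * d2.
Proof.
move=> D3 d20; have [S0 S1 S2] := cubic_sums D3.
have D0 : (0 < D)%N by lia. have D1 : (D.-1 < D)%N by lia.
have D2' : (1 < D)%N by lia.
have inordD : inord D = inord D.-1.+1 :> 'I_D.+1 by rewrite prednK.
rewrite inordD -!nodeE.
apply: (@product_lt R 'I_D node_weight node (b 0 + 1 - b 1 - c 2) _ _ (b 2 * c 2)) => //.
- exact: node_weight_gt0.
- exact: node_inj.
- by apply: b_gt0.
- by apply: mulr_gt0; [apply: b_gt0; lia | apply: c_gt0; lia].
- by rewrite card_ord.
- by rewrite -[RHS]S0 -[RHS]sum_lift.
- by rewrite -[RHS]S1 -[RHS]sum_lift.
- by rewrite -[RHS]S2 -[RHS]sum_lift.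
- by move=> i; apply: node_le.
- by move=> i; apply: node_le; have := ltn_ord i; rewrite /=; lia.
move=> i; rewrite -val_eqE /= => iD; apply: node_le.
by rewrite /= lt0n.
Qed.

End OrthogonalRecurrence.

Theorem theorem4p1 (R : rcfType) (X : finType) (D : nat)
  (r : X -> X -> 'I_D.+1)
  (E : 'I_D.+1 -> 'M[R]_#|X|)
  (q : 'I_D.+1 -> 'I_D.+1 -> 'I_D.+1 -> R)
  (theta : 'I_D.+1 -> R)
  (D_ge2 : (2 <= D)%N)
  (r_scheme : symmetric_scheme r)
  (E_ordering : idempotent_ordering r E)
  (q_krein : krein_parameters E q)
  (q_Qpoly : q_polynomial q)
  (theta_dual : dual_eigenvalues r E theta)
  (theta_decr : forall h k : 'I_D.+1, (h < k)%N -> theta k < theta h) :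
  let m := bstar q 0 in
  let b := bstar q in
  let c := cstar q in
  let th (i : nat) := theta (inord i) in
  ((th 1%N + 1) * (th D + 1) <= - b 1%N /\
   ((th 1%N + 1) * (th D + 1) = - b 1%N <-> D = 2%N)) /\
  ((3 <= D)%N ->
   (b 2%N + c 3%N >= m + 1 ->
     (th 1%N + 1) * (th D.-1 + 1) * (th D + 1)
       >= - b 1%N * (m + 1 - b 2%N - c 3%N) /\
     ((th 1%N + 1) * (th D.-1 + 1) * (th D + 1)
       = - b 1%N * (m + 1 - b 2%N - c 3%N) <-> D = 3%N)) /\
   (b 2%N + c 3%N <= m + 1 ->
     (th 1%N + 1) * (th 2%N + 1) * (th D + 1)
       <= - b 1%N * (m + 1 - b 2%N - c 3%N) /\
     ((th 1%N + 1) * (th 2%N + 1) * (th D + 1)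
       = - b 1%N * (m + 1 - b 2%N - c 3%N) <-> D = 3%N))).
Proof.
move=> m b c th.
pose u := scaled_coef r E; pose K := @pair_count R X D r.
pose M := @multiplicity R X D E; pose q1 := q (inord 1).
have K0 : forall h, 0 < K h by exact: (pair_count_gt0 R r_scheme).
have M0 : forall i, 0 < M i by exact: (multiplicity_gt0 r_scheme E_ordering).
have uu i j : \sum_h K h * (u i h * u j h) = if i == j then M i else 0.
  exact: (coef_orth r_scheme E_ordering).
have u0 h : u ord0 h = 1 by exact: (coef_ord0 r_scheme E_ordering).
have us h : \sum_i u i h = if h == ord0 then #|X|%:R else 0.
  exact: (sum_coef r_scheme E_ordering).
have um j h : u (inord 1) h * u j h = \sum_l q1 j l * u l h.
  exact: (coef_mul r_scheme E_ordering).
have ut h : u (inord 1) h = theta h by exact: (coef_dual r_scheme E_ordering).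
have q0 (j h : 'I_D.+1) : (j.+1 < h)%N || (h.+1 < j)%N -> q1 j h = 0.
  by move=> jh; apply: (q_Qpoly j h).1; lia.
have qn (j h : 'I_D.+1) : (j.+1 == h)%N || (h.+1 == j)%N -> q1 j h != 0.
  by move=> jh; apply/eqP/(q_Qpoly j h).2; lia.
have ud (h k : 'I_D.+1) : (h < k)%N -> u (inord 1) k < u (inord 1) h.
  by rewrite !ut; apply: theta_decr.
have tE i : th i + 1 = shifted u (inord i) by rewrite /shifted ut.
rewrite !tE; split.
  exact: (dual_top_bottom K0 M0 uu u0 us um q0 ud D_ge2).
move=> D3; set d := m + 1 - b 2%N - c 3%N.
have lt_d (D4 : (3 < D)%N) (d0 : 0 <= d) :
    shifted u (inord 1) * shifted u (inord 2) * shifted u (inord D) < - b 1%N * d.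
  exact: (dual_product_lt K0 M0 uu u0 us um q0 qn ud D_ge2).
have gt_d (D4 : (3 < D)%N) (d0 : d <= 0) :
    - b 1%N * d < shifted u (inord 1) * shifted u (inord D.-1) * shifted u (inord D).
  exact: (dual_product_gt K0 M0 uu u0 us um q0 qn ud D_ge2).
have eq_d (D3' : D = 3) :
    shifted u (inord 1) * shifted u (inord 2) * shifted u (inord D) = - b 1%N * d.
  have -> : inord D = inord 3 :> 'I_D.+1 by congr inord.
  exact: (dual_product3 M0 uu u0 us um q0 ud D_ge2).
have pred_D (D3' : D = 3) : inord D.-1 = inord 2 :> 'I_D.+1.
  by congr inord; rewrite D3'.
have [D4|D_le3] := ltnP 3 D; last first.
  have D3' : D = 3 by lia.
  by rewrite pred_D // eq_d.
have neD : D = 3 <-> False by split=> // D3'; rewrite D3' in D4.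
split=> bc; (split; last (rewrite neD; split=> // e)).
- by apply/ltW/gt_d => //; rewrite /d; lra.
- by have := gt_d D4; rewrite e ltxx => /(_ _)/negP; apply; rewrite /d; lra.
- by apply/ltW/lt_d => //; rewrite /d; lra.
- by have := lt_d D4; rewrite e ltxx => H; have : false by apply: H; rewrite /d; lra.
Qed.
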